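(* Let $N \in \mathbb{N}$, let $K$ be an integral domain, let $A_1, \ldots, A_N$ be finite nonempty subsets of $\mathrm{Tor}(K)$, and let $Q := A_1 \times \cdots \times A_N$. Let \[ r := \max\left( \{ \mathrm{ord}(u/v) \mid u, v \in A_i,\ i \in \{1,\ldots,N\} \} \cup \{2\} \right), \] let $t := \frac{r}{r-1}$, and let $p \in K[X_1, \ldots, X_N]$. Assume that there is $\mathbf{c} \in Q$ such that $p(\mathbf{c}) \neq 0$. Then for every $\mathbf{a} \in Q$, there is $\mathbf{b} \in Q$ with $p(\mathbf{b}) \neq 0$ and \[ d_H(\mathbf{a}, \mathbf{b}) \le \log_t (M(p)). \]
   Context: $\mathbb{N}$ denotes the set of positive integers. For a commutative ring $K$ with $1$, $\mathrm{Tor}(K) := \{ t \in K \mid \exists n \in \mathbb{N} : t^n = 1 \}$ is the torsion part of the multiplicative group of units of $K$, and for $t \in \mathrm{Tor}(K)$, $\mathrm{ord}(t) := \min\{ n \in \mathbb{N} \mid t^n = 1 \}$ is its multiplicative order. For $\mathbf{a}, \mathbf{b} \in K^N$, the Hamming distance is $d_H(\mathbf{a}, \mathbf{b}) := \#\{ i \in \{1,\ldots,N\} \mid a_i \neq b_i \}$. $M(p)$ denotes the number of monomials that appear in the polynomial $p$ with nonzero coefficient. *)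

(* Defs.v *)
From HB Require Import structures.
From mathcomp Require Export all_boot all_order all_algebra finmap.
From mathcomp Require Export boolp classical_sets reals exp.
(* mpoly is not imported: its notations clash with those of
   mathcomp-analysis.  Its constants are used with qualified names. *)
From mathcomp Require mpoly.

Set Implicit Arguments.
Unset Strict Implicit.
Unset Printing Implicit Defensive.

Import Order.TTheory GRing.Theory Num.Theory.
Local Open Scope classical_set_scope.
Local Open Scope ring_scope.

Definition Tor (K : comPzRingType) : set K :=
  [set t | exists n : nat, (0 < n)%N /\ t ^+ n = 1].

(* The value outside Tor K is the junk value 0. *)
Definition ord (K : comPzRingType) (t : K) : nat :=
  if pselect (exists n : nat, (0 < n)%N && (t ^+ n == 1)) is left h
  then ex_minn h else 0%N.

Definition hamming (K : eqType) (N : nat) (a b : 'I_N -> K) : nat :=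
  #|[pred i | a i != b i]|.

Definition box (K : choiceType) (N : nat) (A : 'I_N -> {fset K}) :
    set ('I_N -> K) :=
  [set c | forall i, c i \in A i].

Definition max_ord (K : idomainType) (N : nat) (A : 'I_N -> {fset K}) : nat :=
  maxn (\max_(i < N) \max_(u <- A i) \max_(v <- A i) ord (u / v)) 2.

Definition nb_monomials (N : nat) (K : nzRingType) (p : mpoly.mpoly N K) : nat :=
  size (mpoly.msupp p).

Definition logb (R : realType) (t x : R) : R := ln x / ln t.

(* Main.v *)
(* Take b in Q nearest to a with p(b) <> 0, let D be the set of coordinates where
   they differ, and d = |D|.  Then p vanishes at every other point of Q whose
   coordinates are picked from those of a and b, and so does X^s p for every
   exponent s.  An alternating sum over these points shows that, for every s,
   some monomial X^m of p has b_i^(s_i + m_i) <> a_i^(s_i + m_i) for all i in D.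
   As b_i / a_i has order at most r, for a fixed i each monomial fails this for
   some s_i < r; so s can be chosen to leave at most M(p) ((r - 1) / r)^d
   monomials.  One is left, hence (r / (r - 1))^d <= M(p). *)
Require Import Defs.
From mathcomp Require mpoly.
From mathcomp Require Import zify.

Set Implicit Arguments.
Unset Strict Implicit.
Unset Printing Implicit Defensive.

Import Order.TTheory GRing.Theory Num.Theory.
Import (canonicals) mpoly.
Local Open Scope classical_set_scope.
Local Open Scope ring_scope.

(** Double counting: each [x] is counted by some [P j] with [j < r], so the [r] counts sum to at
    least [size s], and the largest is at least their average. *)
Lemma pigeonhole_seq (T : eqType) (r : nat) (P : nat -> pred T) (s : seq T) :
  {in s, forall x, exists2 j, (j < r)%N & P j x} ->
  exists j, (size s <= r * count (P j) s)%N.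
Proof.
case: s => [|x0 s0]; first by exists 0%N.
set s := x0 :: s0 => hP.
have [j0 j0r _] := hP x0 (mem_head _ _).
have [j _ jmax] := @arg_maxnP _ (Ordinal j0r) xpredT
  (fun j : 'I_r => count (P j) s) isT.
exists j; apply: (@leq_trans (\sum_(k < r) count (P k) s)); last first.
  rewrite -[X in (_ <= X * _)%N]card_ord -sum_nat_const.
  by apply: leq_sum => k _; apply: jmax.
under eq_bigr do rewrite -sum1_count big_mkcond.
rewrite exchange_big -sum1_size /= big_seq [leqRHS]big_seq.
apply: leq_sum => x /hP[k kr Pkx].
by rewrite (bigD1 (Ordinal kr)) //= Pkx.
Qed.

(* Choosing the shifts one coordinate at a time, each choice discards at least
   a fraction 1/r of what is left. *)
Lemma greedy_shift (I T : eqType) (r : nat) (bad : I -> nat -> pred T)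
    (D : seq I) (s : seq T) : uniq D ->
  {in D & s, forall i x, exists2 j, (j < r)%N & bad i j x} ->
  exists f : I -> nat,
    (r ^ size D * count (fun x => all (fun i => ~~ bad i (f i) x) D) s
       <= r.-1 ^ size D * size s)%N.
Proof.
elim: D s => [|i D IH] s /=.
  by move=> _ _; exists (fun=> 0%N); rewrite !expn0 !mul1n count_size.
case/andP=> iD uD hbad.
have [j hj] : exists j, (size s <= r * count (bad i j) s)%N.
  by apply: pigeonhole_seq => x xs; apply: hbad; rewrite ?mem_head.
have [|f hf] := IH [seq x <- s | ~~ bad i j x] uD.
  move=> k x kD; rewrite mem_filter => /andP[_ xs].
  by apply: hbad => //; rewrite inE kD orbT.
(* Since [i] is not in [D], overriding [f] at [i] leaves the conditions indexed by [D] unchanged. *)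
exists (fun k => if k == i then j else f k).
have -> : count (fun x => ~~ bad i (if i == i then j else f i) x &&
    all (fun k => ~~ bad k (if k == i then j else f k) x) D) s =
  count (fun x => all (fun k => ~~ bad k (f k) x) D) [seq x <- s | ~~ bad i j x].
  rewrite count_filter; apply: eq_count => x /=; rewrite eqxx andbC.
  congr (_ && _); apply: eq_in_all => k kD.
  by case: eqP => // ki; rewrite -ki kD in iD.
rewrite !expnS -mulnA.
apply: leq_trans (leq_mul (leqnn r) hf) _.
rewrite mulnCA [leqRHS]mulnAC [leqRHS]mulnC leq_mul2l; apply/orP; right.
rewrite size_filter.
have := count_predC (bad i j) s; have := hj.
rewrite (@eq_count _ (predC _) (fun x => ~~ bad i j x)) //.
(* From [n = c + c'] and [n <= r * c] follows [r * c' <= (r - 1) * n]. *)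
by move: (count _ s) (count _ s) (size s) => c c' n; case: (r) => [|q]; nia.
Qed.

Lemma sum_seq_neq0 (V : nmodType) (T : eqType) (s : seq T) (F : T -> V) :
  \sum_(x <- s) F x != 0 -> exists2 x, x \in s & F x != 0.
Proof.
move=> sF; apply/hasP/contraT => /hasPn F0.
by rewrite big_seq big1 ?eqxx // in sF => x /F0 /negPn/eqP.
Qed.

(* The alternating sum of X^s p over the points of \prod_i {a i, b i} that agree
   with b where a i = b i reduces to its term at b, hence is nonzero; expanding
   p into monomials it is the sum of the products of the differences
   b i ^ (s i + m i) - a i ^ (s i + m i). *)
Lemma surviving_monomial (N : nat) (K : idomainType) (p : mpoly.mpoly N K)
    (a b : 'I_N -> K) (s : 'I_N -> nat) :
  (forall i, b i != 0) -> mpoly.meval b p != 0 ->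
  (forall x, (forall i, x i = a i \/ x i = b i) ->
     (hamming a x < hamming a b)%N -> mpoly.meval x p = 0) ->
  exists2 m, m \in mpoly.msupp p & forall i, a i != b i ->
    b i ^+ (s i + mpoly.fun_of_multinom m i) !=
    a i ^+ (s i + mpoly.fun_of_multinom m i).
Proof.
move=> b0 pb pmin.
(* Where [a i = b i] both choices give the same value; the weight 0 keeps only one of them, so that
   they do not cancel. *)
pose w i (e : bool) : K := if e then 1 else if a i == b i then 0 else -1.
pose pt i (e : bool) := if e then b i else a i.
pose x (f : {ffun 'I_N -> bool}) i := pt i (f i).
pose S := \sum_(f : {ffun 'I_N -> bool})
  (\prod_i (w i (f i) * x f i ^+ s i)) * mpoly.meval (x f) p.
have S0 : S != 0.
  rewrite /S (bigD1 [ffun=> true]) //= [X in _ + X]big1 => [|f /eqP fT].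
    have -> : x [ffun=> true] = b by apply: funext => i; rewrite /x ffunE.
    rewrite addr0 mulf_neq0 //; apply/prodf_neq0 => i _.
    by rewrite ffunE mul1r expf_neq0.
  have [i fi] : exists i, f i = false.
    apply: contra_notP fT => /forallNP nf; apply/ffunP => i; rewrite ffunE.
    by case: (f i) (nf i).
  (* A choice of [a] at [i] either has weight 0 or gives a point strictly nearer to [a] than [b] is,
     where [p] vanishes. *)
  have [abi|abi] := eqVneq (a i) (b i).
    by rewrite (bigD1 i) //= fi /w abi eqxx !mul0r.
  rewrite (pmin (x f)) ?mulr0 //.
    by move=> k; rewrite /x /pt; case: (f k); [right|left].
  apply: proper_card; apply/properP; split.
    apply/fintype.subsetP => k; rewrite !inE /x /pt; case: (f k) => //.
    by rewrite eqxx.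
  by exists i; rewrite !inE // /x fi eqxx.
have SE : S = \sum_(m <- mpoly.msupp p) mpoly.mcoeff m p *
    \prod_i \sum_(e : bool) w i e * pt i e ^+ (s i + mpoly.fun_of_multinom m i).
  under [RHS]eq_bigr do rewrite bigA_distr_bigA mulr_sumr.
  rewrite exchange_big /=; apply: eq_bigr => f _.
  rewrite mpoly.mevalE mulr_sumr; apply: eq_bigr => m _.
  rewrite mulrCA -big_split /=; congr (_ * _); apply: eq_bigr => i _.
  by rewrite -mulrA -exprD.
move: S0; rewrite SE => /sum_seq_neq0[m mp].
rewrite mulf_eq0 negb_or => /andP[_ /prodf_neq0 hm].
exists m => // i abi; apply: contraNneq (hm i isT) => E.
by rewrite big_bool /w /pt /= (negbTE abi) E mul1r mulN1r subrr.
Qed.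

Lemma ordP (K : comPzRingType) (t : K) : Tor t ->
  (0 < ord t)%N /\ t ^+ ord t = 1.
Proof.
rewrite /ord => -[n [n0 tn]]; case: pselect => [h|[]]; last first.
  by exists n; rewrite n0 tn eqxx.
by case: ex_minnP => k /andP[k0 /eqP].
Qed.

Lemma Tor_unit (K : comUnitRingType) (t : K) : Tor t -> t \is a GRing.unit.
Proof. by move=> [n [n0 tn]]; rewrite -(unitrX_pos _ n0) tn unitr1. Qed.

Lemma Tor_div (K : comUnitRingType) (u v : K) : Tor u -> Tor v -> Tor (u / v).
Proof.
move=> [m [m0 um]] [n [n0 vn]]; exists (m * n)%N; rewrite muln_gt0 m0 n0.
split=> //; rewrite expr_div_n exprM um expr1n mulnC exprM vn expr1n.
by rewrite divr1.
Qed.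

Lemma Tor_expr_shift (K : comUnitRingType) (u v : K) (m : nat) :
  Tor u -> Tor v -> exists2 j, (j < ord (u / v))%N & u ^+ (j + m) = v ^+ (j + m).
Proof.
move=> uT vT; have [n0 nE] := ordP (Tor_div uT vT); set n := ord _ in n0 nE *.
(* This is the residue of [-m] modulo [n], so [n] divides its sum with [m]. *)
exists ((m * n.-1) %% n)%N; first by rewrite ltn_mod.
set k := (_ + m)%N; have kE : (u / v) ^+ k = 1.
  have /dvdnP[q ->] : (n %| k)%N.
    by rewrite /k /dvdn modnDml -mulnSr prednK // modnMl.
  by rewrite mulnC exprM nE expr1n.
by rewrite -[LHS](divrK (unitrX k (Tor_unit vT))) -expr_div_n kE mul1r.
Qed.

Lemma ord_div_le_max_ord (N : nat) (K : idomainType) (A : 'I_N -> {fset K})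
    (i : 'I_N) (u v : K) :
  u \in A i -> v \in A i -> (ord (u / v) <= max_ord A)%N.
Proof.
move=> uA vA; apply: leq_trans (leq_maxl _ _).
apply: (@bigmaxn_sup_seq _ _ i) => //; first exact: mem_index_enum.
apply: (@bigmaxn_sup_seq _ _ u) => //.
exact: (@leq_bigmax_seq _ _ _ (fun w => ord (u / w)) v).
Qed.

Lemma hamming_expn_le (N : nat) (K : idomainType) (A : 'I_N -> {fset K})
    (p : mpoly.mpoly N K) (a b : 'I_N -> K) :
  (forall i, [set` A i] `<=` Tor (K := K)) -> box A a -> box A b ->
  mpoly.meval b p != 0 ->
  (forall x, box A x -> (hamming a x < hamming a b)%N -> mpoly.meval x p = 0) ->
  (max_ord A ^ hamming a b
     <= (max_ord A).-1 ^ hamming a b * nb_monomials p)%N.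
Proof.
move=> AT aA bA pb pmin.
pose bad i j (m : mpoly.multinom N) :=
  b i ^+ (j + mpoly.fun_of_multinom m i) == a i ^+ (j + mpoly.fun_of_multinom m i).
have [|f] := @greedy_shift _ _ (max_ord A) bad
    (enum [pred i | a i != b i]) (mpoly.msupp p) (enum_uniq _).
  move=> i m _ _.
  have [j jlt jE] := Tor_expr_shift (mpoly.fun_of_multinom m i)
    (AT i _ (bA i)) (AT i _ (aA i)).
  exists j; last exact/eqP.
  exact: leq_trans jlt (ord_div_le_max_ord (bA i) (aA i)).
rewrite -cardE -[#|_|]/(hamming a b); apply: leq_trans.
have [|x xab|m mp mE] := @surviving_monomial _ _ p a b f _ pb.
- by move=> i; apply: contraTneq (Tor_unit (AT i _ (bA i))) => ->; rewrite unitr0.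
- by apply: pmin => i; case: (xab i) => ->; [apply: aA | apply: bA].
(* The surviving monomial makes the count in the greedy bound at least 1, so [r ^ d] is below the
   left side of that bound. *)
rewrite leq_pmulr // -has_count; apply/hasP; exists m => //.
by apply/allP => i; rewrite mem_enum => /mE.
Qed.

Lemma natr_le_logb (R : realType) (r d M : nat) : (1 < r)%N ->
  (r ^ d <= r.-1 ^ d * M)%N -> d%:R <= logb (r%:R / (r%:R - 1)) M%:R :> R.
Proof.
case: r => [|r] // r1 h; have r0 : 0 < r%:R :> R by rewrite ltr0n.
rewrite /logb -[X in _ - X]/(1%:R) -natrB // subn1 /=.
have t1 : 1 < r.+1%:R / r%:R :> R by rewrite ltr_pdivlMr // mul1r ltr_nat.
have t0 := lt_trans ltr01 t1.
have htM : (r.+1%:R / r%:R) ^+ d <= M%:R :> R.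
  rewrite expr_div_n ler_pdivrMr ?exprn_gt0 // -!natrX -natrM ler_nat.
  by rewrite mulnC.
rewrite ler_pdivlMr ?ln_gt0 // (mulr_natl _ d) -lnXn // ler_ln ?posrE ?exprn_gt0 //.
exact: lt_le_trans (exprn_gt0 d t0) htM.
Qed.

Theorem theorem3p1 (R : realType) (N : nat) (K : idomainType)
    (A : 'I_N -> {fset K}) (p : mpoly.mpoly N K) :
  (0 < N)%N ->
  (forall i, A i != fset0) ->
  (forall i, [set` A i] `<=` Tor (K := K)) ->
  (exists c, box A c /\ mpoly.meval c p != 0) ->
  let r := max_ord A in
  let t : R := r%:R / (r%:R - 1) in
  forall a, box A a ->
    exists b, [/\ box A b, mpoly.meval b p != 0 &
      (hamming a b)%:R <= logb t (nb_monomials p)%:R].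
Proof.
move=> _ _ AT [c [cA pc]] r t a aA.
pose P n := `[< exists b, [/\ box A b, mpoly.meval b p != 0 & hamming a b = n] >].
have exP : exists n, P n by exists (hamming a c); apply/asboolP; exists c.
case: (ex_minnP exP) => n /asboolP[b [bA pb <-{n}]] bmin.
(* The 2 in the maximum gives [1 < r], so [t > 1] and [ln t > 0]. *)
exists b; split=> //; apply: natr_le_logb; first exact: leq_maxr.
apply: hamming_expn_le => // x xA; rewrite ltnNge; apply: contraNeq => px.
by apply: bmin; apply/asboolP; exists x.
Qed.
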